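(* (a) The following expressions are $e$-positive: (i) $z^2E''(z)-zE'(z)+e_1z$; (ii) $2z^2E''(z)-3zE'(z)+3e_1z+2e_2z^2$; (iii) $z^2E''(z)-3zE'(z)+3E(z)+e_2z^2$. (b) The following expressions can be written as rational functions with $e$-positive numerators: (i) $\mathcal{X}_P(z)-(1+e_1z)$; (ii) $(1+e_1z)\,\mathcal{X}_C(z)-\mathcal{X}_P(z)+1+e_1z$.
   Context: $e_i$ is the $i$-th elementary symmetric function ($e_0=1$), $E(z)=\sum_{i\ge 0}e_iz^i$, and derivatives are with respect to $z$. A power series in $z$ over symmetric functions is $e$-positive if each coefficient has nonnegative coefficients in the basis of elementary symmetric functions $e_\lambda$. The chromatic symmetric function of a finite simple graph $H=(V,E)$ is $X_H=\sum_\kappa\prod_{u\in V}x_{\kappa(u)}$, the sum over all proper colorings $\kappa:V\to\mathbb{Z}_{>0}$. $P_n$ and $C_n$ are the path and cycle on $n$ vertices (with $X_{P_0}=1$ and $X_{C_2}=2e_2$); $\mathcal{X}_P(z)=\sum_{n\ge 0}X_{P_n}z^n$ and $\mathcal{X}_C(z)=\sum_{n\ge 2}X_{C_n}z^n$. It is known (Stanley) that $\mathcal{X}_P(z)=E(z)/D(z)$ and $\mathcal{X}_C(z)=z^2E''(z)/D(z)$, where $D(z)=E(z)-zE'(z)=1-\sum_{i\ge 2}(i-1)e_iz^i$. *)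

(* Defs.v *)
From HB Require Import structures.
From mathcomp Require Import all_boot all_order all_algebra.
From mathcomp Require Import fingroup perm boolp mpoly.

Set Implicit Arguments.
Unset Strict Implicit.
Unset Printing Implicit Defensive.

Import Order.TTheory GRing.Theory Num.Theory.
Local Open Scope ring_scope.

(* The ring of symmetric functions over Q, as the graded inverse limit of the
   rings of symmetric polynomials: f(x_1, x_2, ...) is given by its
   specializations f N = f(x_1, ..., x_N, 0, 0, ...), which are symmetric,
   compatible, and of bounded degree. The variable x_(i+1) is 'X_i. *)

Definition kill_last (n : nat) (p : {mpoly rat[n.+1]}) : {mpoly rat[n]} :=
  p \mPo [tuple if unlift ord_max i is Some j then 'X_j else 0 | i < n.+1].

Definition symfun_axiom (f : forall n : nat, {mpoly rat[n]}) : Prop :=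
  [/\ forall n, f n \is symmetric,
      forall n, kill_last (f n.+1) = f n
    & exists d, forall n, (msize (f n) <= d)%N].

Record symfun := SymFun {
  symfun_at :> forall n : nat, {mpoly rat[n]};
  symfunP : symfun_axiom symfun_at
}.

Lemma symfun_eq (f g : symfun) : (forall n, f n = g n) -> f = g.
Proof.
case: f g => [f pf] [g pg] /= eqfg.
have {}eqfg : f = g by apply: functional_extensionality_dep.
by subst g; congr SymFun; apply: Prop_irrelevance.
Qed.

HB.instance Definition _ := gen_eqMixin symfun.
HB.instance Definition _ := gen_choiceMixin symfun.

Section SymFunRing.

Lemma kill_lastD n : {morph @kill_last n : p q / p + q}.
Proof. exact: rmorphD. Qed.

Lemma kill_lastM n : {morph @kill_last n : p q / p * q}.
Proof. exact: rmorphM. Qed.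

Lemma symfun0_subproof : symfun_axiom (fun=> 0).
Proof.
split=> [n|n|]; [exact: rpred0 | exact: rmorph0 |].
by exists 0%N => n; rewrite msize0.
Qed.
Definition symfun0 := SymFun symfun0_subproof.

Lemma symfun1_subproof : symfun_axiom (fun=> 1).
Proof.
split=> [n|n|]; [exact: rpred1 | exact: rmorph1 |].
by exists 1%N => n; rewrite msize1.
Qed.
Definition symfun1 := SymFun symfun1_subproof.

Lemma symfun_opp_subproof (f : symfun) : symfun_axiom (fun n => - f n).
Proof.
case: f => f [fS fK [d fd]] /=; split=> [n|n|].
- by rewrite rpredN; apply: fS.
- by rewrite /kill_last rmorphN /= -/(kill_last _) fK.
- by exists d => n; rewrite mmeasureN.
Qed.
Definition symfun_opp f := SymFun (symfun_opp_subproof f).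

Lemma symfun_add_subproof (f g : symfun) : symfun_axiom (fun n => f n + g n).
Proof.
case: f g => f [fS fK [d fd]] [g [gS gK [d' gd]]] /=; split=> [n|n|].
- by rewrite rpredD ?fS ?gS.
- by rewrite kill_lastD fK gK.
- exists (maxn d d') => n; apply: leq_trans (mmeasureD_le _ _ _) _.
  by rewrite geq_max !leq_max fd gd orbT.
Qed.
Definition symfun_add f g := SymFun (symfun_add_subproof f g).

Lemma symfun_mul_subproof (f g : symfun) : symfun_axiom (fun n => f n * g n).
Proof.
case: f g => f [fS fK [d fd]] [g [gS gK [d' gd]]] /=; split=> [n|n|].
- by rewrite rpredM ?fS ?gS.
- by rewrite kill_lastM fK gK.
- exists (d + d')%N => n; have [->|f0] := eqVneq (f n) 0.
    by rewrite mul0r msize0.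
  have [->|g0] := eqVneq (g n) 0; first by rewrite mulr0 msize0.
  by rewrite msizeM // (leq_trans (leq_pred _)) // leq_add.
Qed.
Definition symfun_mul f g := SymFun (symfun_mul_subproof f g).

Lemma symfun_scale_subproof (c : rat) (f : symfun) :
  symfun_axiom (fun n => c *: f n).
Proof.
case: f => f [fS fK [d fd]] /=; split=> [n|n|].
- by rewrite rpredZ ?fS.
- by rewrite /kill_last comp_mpolyZ -/(kill_last _) fK.
- by exists d => n; rewrite (leq_trans (msizeZ_le _ _)).
Qed.
Definition symfun_scale c f := SymFun (symfun_scale_subproof c f).

Fact symfun_addA : associative symfun_add.
Proof. by move=> f g h; apply: symfun_eq => n /=; rewrite addrA. Qed.
Fact symfun_addC : commutative symfun_add.
Proof. by move=> f g; apply: symfun_eq => n /=; rewrite addrC. Qed.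
Fact symfun_add0 : left_id symfun0 symfun_add.
Proof. by move=> f; apply: symfun_eq => n /=; rewrite add0r. Qed.
Fact symfun_addN : left_inverse symfun0 symfun_opp symfun_add.
Proof. by move=> f; apply: symfun_eq => n /=; rewrite addNr. Qed.

HB.instance Definition _ :=
  GRing.isZmodule.Build symfun symfun_addA symfun_addC symfun_add0 symfun_addN.

Fact symfun_mulA : associative symfun_mul.
Proof. by move=> f g h; apply: symfun_eq => n /=; rewrite mulrA. Qed.
Fact symfun_mulC : commutative symfun_mul.
Proof. by move=> f g; apply: symfun_eq => n /=; rewrite mulrC. Qed.
Fact symfun_mul1 : left_id symfun1 symfun_mul.
Proof. by move=> f; apply: symfun_eq => n /=; rewrite mul1r. Qed.
Fact symfun_mulDl : left_distributive symfun_mul +%R.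
Proof. by move=> f g h; apply: symfun_eq => n /=; rewrite mulrDl. Qed.
Fact symfun1_neq0 : symfun1 != 0.
Proof.
apply/eqP => /(congr1 (fun f : symfun => f 0%N)) /= /eqP.
by rewrite oner_eq0.
Qed.

HB.instance Definition _ :=
  GRing.Zmodule_isComNzRing.Build symfun
    symfun_mulA symfun_mulC symfun_mul1 symfun_mulDl symfun1_neq0.

Fact symfun_scaleA a b f :
  symfun_scale a (symfun_scale b f) = symfun_scale (a * b) f.
Proof. by apply: symfun_eq => n /=; rewrite scalerA. Qed.
Fact symfun_scale1 : left_id 1 symfun_scale.
Proof. by move=> f; apply: symfun_eq => n /=; rewrite scale1r. Qed.
Fact symfun_scaleDr : right_distributive symfun_scale +%R.
Proof. by move=> a f g; apply: symfun_eq => n /=; rewrite scalerDr. Qed.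
Fact symfun_scaleDl f : {morph symfun_scale^~ f : a b / a + b}.
Proof. by move=> a b; apply: symfun_eq => n /=; rewrite scalerDl. Qed.

HB.instance Definition _ :=
  GRing.Zmodule_isLmodule.Build rat symfun
    symfun_scaleA symfun_scale1 symfun_scaleDr symfun_scaleDl.

End SymFunRing.

Lemma kill_lastX n (i : 'I_n) : kill_last 'X_(lift ord_max i) = 'X_i.
Proof. by rewrite /kill_last comp_mpolyXU -tnth_nth tnth_mktuple liftK. Qed.

Lemma kill_lastX_max n : kill_last 'X_(@ord_max n) = 0.
Proof. by rewrite /kill_last comp_mpolyXU -tnth_nth tnth_mktuple unlift_none. Qed.

Lemma mwidenK n : cancel (@mwiden n rat) (@kill_last n).
Proof.
elim/mpolyind => [|c m p _ _ IHp]; first by rewrite mwiden0 /kill_last comp_mpoly0.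
rewrite mwidenD kill_lastD IHp mwidenZ; congr (_ + _).
rewrite /kill_last comp_mpolyZ -/(kill_last _); congr (_ *: _).
rewrite /mwiden mmapX /mmap1 /kill_last rmorph_prod /= [RHS]mpolyXE_id.
apply: eq_bigr => i _; rewrite rmorphXn /= -/(kill_last _); congr (_ ^+ _).
have -> : widen_ord (leqnSn n) i = lift ord_max i.
  by apply/val_inj; rewrite /= /bump leqNgt ltn_ord.
exact: kill_lastX.
Qed.

Lemma esf_subproof (k : nat) : symfun_axiom (fun n => mesym n rat k).
Proof.
split=> [n|n|].
- exact: mesym_sym.
- case: k => [|k]; first by rewrite !mesym0E [LHS]rmorph1.
  by rewrite mesymSS kill_lastD kill_lastM !mwidenK kill_lastX_max mulr0 addr0.
- exists k.+1 => n; rewrite mesymE; apply: leq_trans (msize_sum _ _ _) _.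
  apply/bigmax_leqP => h /eqP hk.
  by rewrite msizeX mdeg_mesym1 hk.
Qed.

Definition esf (k : nat) : symfun := SymFun (esf_subproof k).

Definition is_partition (la : seq nat) : bool := sorted geq la && (0%N \notin la).

Definition esf_part (la : seq nat) : symfun := \prod_(k <- la) esf k.

(* As the e_la, la a partition, form a basis of symfun, such an expansion is
   the expansion of f in this basis. *)
Definition e_positive (f : symfun) : Prop :=
  exists (s : seq (seq nat)) (c : seq nat -> rat),
    [/\ uniq s, all is_partition s, {in s, forall la, 0 <= c la}
      & f = \sum_(la <- s) c la *: esf_part la].

Record sgraph := SGraph {
  vertex : finType;
  edge : rel vertex;
  edge_sym : forall u v, edge u v = edge v u;
  edge_irr : forall u, edge u u = false
}.

Section Chromatic.

Variable G : sgraph.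

Definition proper_coloring n (kappa : {ffun vertex G -> 'I_n}) : bool :=
  [forall u, forall v, edge u v ==> (kappa u != kappa v)].

(* X_G(x_1, ..., x_n, 0, 0, ...): only the colorings with values among the
   first n colors survive. *)
Definition chromatic_poly n : {mpoly rat[n]} :=
  \sum_(kappa : {ffun vertex G -> 'I_n} | proper_coloring kappa)
    \prod_u 'X_(kappa u).

Lemma proper_coloring_inj m n (h : 'I_m -> 'I_n)
    (kappa : {ffun vertex G -> 'I_m}) : injective h ->
  proper_coloring [ffun u => h (kappa u)] = proper_coloring kappa.
Proof.
move=> hI; apply: eq_forallb => u; apply: eq_forallb => v.
by rewrite !ffunE (inj_eq hI).
Qed.

Lemma chromatic_subproof : symfun_axiom chromatic_poly.
Proof.
split=> [n|n|].
- apply/issymP => s; rewrite /chromatic_poly raddf_sum /=.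
  have hI (t : 'S_n) : injective (fun k : {ffun vertex G -> 'I_n} => [ffun u => t (k u)]).
    by move=> k k' /ffunP kk; apply/ffunP => u; have := kk u; rewrite !ffunE => /perm_inj.
  rewrite [RHS](reindex_inj (hI s)) /=.
  apply: eq_big => k; first by rewrite proper_coloring_inj //; apply: perm_inj.
  move=> _; rewrite rmorph_prod /=; apply: eq_bigr => u _.
  rewrite msymX ffunE; congr 'X_[_]; apply/mnmP => i.
  rewrite mnmE !mnm1E; congr nat_of_bool.
  by rewrite -(inj_eq (@perm_inj _ s)) permKV.
- rewrite /chromatic_poly /kill_last raddf_sum /=.
  under eq_bigr => k _ do rewrite rmorph_prod /=.
  pose h (k : {ffun vertex G -> 'I_n}) := [ffun u => lift ord_max (k u)].
  have hI : injective h.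
    by move=> k k' /ffunP kk; apply/ffunP => u; have := kk u; rewrite !ffunE => /lift_inj.
  pose A := [set k : {ffun vertex G -> 'I_n} | proper_coloring k].
  rewrite (bigID (mem (h @: A))) /= [X in _ + X]big1 ?addr0.
    rewrite (eq_bigl (mem (h @: A))); last first.
      move=> k; rewrite /= andb_idl // => /imsetP[k' + ->].
      by rewrite inE proper_coloring_inj //; apply: lift_inj.
    rewrite big_imset /=; last by move=> k k' _ _; apply: hI.
    apply: eq_big => k; first by rewrite inE.
    by move=> _; apply: eq_bigr => u _; rewrite ffunE; apply: kill_lastX.
  move=> k /andP[kP kh].
  have [/existsP[u /eqP ku]|/existsPn kN] := boolP [exists u, k u == ord_max].
    by rewrite (bigD1 u) //= ku -/(kill_last _) kill_lastX_max mul0r.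
  case/negP: kh.
  have /fin_all_exists[j jP] u : exists j, k u = lift ord_max j.
    by have [j ->|/eqP] := unliftP ord_max (k u); [exists j | rewrite (negPf (kN u))].
  have kE : k = h (finfun j) by apply/ffunP => u; rewrite !ffunE.
  rewrite kE imset_f // inE -(@proper_coloring_inj _ _ (lift ord_max)) -/(h _) -?kE //.
  exact: lift_inj.
- exists #|vertex G|.+1 => n; apply: leq_trans (msize_sum _ _ _) _.
  apply/bigmax_leqP => k _.
  rewrite -(big_morph _ (@mpolyXD n rat) (@mpolyX0 n rat)) msizeX ltnS.
  rewrite mdeg_sum; apply: leq_trans (_ : \sum_(u : vertex G) 1 <= _)%N; last by rewrite sum1_card.
  by apply: leq_sum => u _; rewrite mdeg1.
Qed.

Definition chromatic : symfun := SymFun chromatic_subproof.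

End Chromatic.

Definition path_edge n : rel 'I_n :=
  fun i j => (i.+1 == j :> nat) || (j.+1 == i :> nat).

Fact path_edge_sym n (i j : 'I_n) : path_edge i j = path_edge j i.
Proof. by rewrite /path_edge orbC. Qed.
Fact path_edge_irr n (i : 'I_n) : path_edge i i = false.
Proof. by rewrite /path_edge orbb gtn_eqF. Qed.

Definition path_graph n : sgraph := SGraph (@path_edge_sym n) (@path_edge_irr n).

Definition cycle_edge n : rel 'I_n :=
  fun i j => (i != j) && ((ordS i == j) || (ordS j == i)).

Fact cycle_edge_sym n (i j : 'I_n) : cycle_edge i j = cycle_edge j i.
Proof. by rewrite /cycle_edge eq_sym orbC. Qed.
Fact cycle_edge_irr n (i : 'I_n) : cycle_edge i i = false.
Proof. by rewrite /cycle_edge eqxx. Qed.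

Definition cycle_graph n : sgraph :=
  SGraph (@cycle_edge_sym n) (@cycle_edge_irr n).

Lemma chromatic_path0 : chromatic (path_graph 0) = 1.
Proof.
apply: symfun_eq => n; rewrite /= /chromatic_poly.
rewrite (big_pred1 [ffun i : 'I_0 => match i with Ordinal _ lt0 => False_rect _ (notF lt0) end]).
  by rewrite big_ord0.
move=> k /=; rewrite (_ : proper_coloring _); last by apply/forallP; case.
by apply/esym/eqP/ffunP; case.
Qed.

Lemma chromatic_cycle2 : chromatic (cycle_graph 2) = 2%:R * esf 2.
Proof.
apply: symfun_eq => n; rewrite mulr_natl mulr2n /= /chromatic_poly.
pose f (t : 2.-tuple 'I_n) : {ffun 'I_2 -> 'I_n} := [ffun i => tnth t i].
pose g (k : {ffun 'I_2 -> 'I_n}) := [tuple k i | i < 2].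
rewrite (reindex f) /=; last first.
  exists g => t _; first by apply/eq_from_tnth => i; rewrite tnth_mktuple ffunE.
  by apply/ffunP => i; rewrite ffunE tnth_mktuple.
pose F (t : 2.-tuple 'I_n) : {mpoly rat[n]} := \prod_(i <- t) 'X_i.
have FE t : \prod_(u < 2) 'X_(f t u) = F t.
  by rewrite /F big_tuple; apply: eq_bigr => i _; rewrite ffunE.
have pE t : proper_coloring (G := cycle_graph 2) (f t) =
    (tnth t ord0 != tnth t ord_max).
  apply/forallP/idP => [/(_ ord0) /forallP /(_ ord_max) /=|tN u].
    by rewrite !ffunE.
  apply/forallP => v; rewrite /= /cycle_edge !ffunE; apply/implyP => /andP[+ _].
  have o2 (i : 'I_2) : i = ord0 \/ i = ord_max.
    by case: i => [[|[|]]] // ?; [left|right]; apply/val_inj.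
  case: (o2 u) => ->; case: (o2 v) => ->; rewrite ?eqxx //=.
  by rewrite eq_sym.
rewrite (eq_bigr F); last by move=> t _; apply: FE.
rewrite (eq_bigl _ _ pE) (bigID (fun t : 2.-tuple 'I_n => tnth t ord0 < tnth t ord_max)%N) /=.
rewrite mesym_tupleE; congr (_ + _).
  apply: eq_bigl => t; case: t => [[|a [|b []]]] //= p.
  rewrite !(tnth_nth a) /tmono /= andbT andb_idl //.
  by apply: contraTneq => ->; rewrite ltnn.
pose r (t : 2.-tuple 'I_n) : 2.-tuple 'I_n := [tuple of rev t].
have rK : involutive r by move=> t; apply/val_inj; rewrite /= revK.
rewrite (reindex_inj (can_inj rK)); apply: eq_big => t.
  case: t => [[|a [|b []]]] //= p.
  rewrite !(tnth_nth a) /tmono /= andbT -leqNgt leq_eqVlt -(inj_eq val_inj) /=.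
  by rewrite eq_sym; case: ltngtP.
by move=> _; rewrite /F /= big_rev.
Qed.

Record fps (A : Type) := FPS { coefz : nat -> A }.

Section FPSRing.

Variable A : comNzRingType.
Implicit Types f g h : fps A.

HB.instance Definition _ := gen_eqMixin (fps A).
HB.instance Definition _ := gen_choiceMixin (fps A).

Lemma fps_eq f g : coefz f =1 coefz g -> f = g.
Proof. by case: f g => [f] [g] /= /funext ->. Qed.

Definition fps0 : fps A := FPS (fun=> 0).
Definition fps1 : fps A := FPS (fun n => (n == 0%N)%:R).
Definition fps_opp f : fps A := FPS (fun n => - coefz f n).
Definition fps_add f g : fps A := FPS (fun n => coefz f n + coefz g n).
Definition fps_mul f g : fps A :=
  FPS (fun n => \sum_(i < n.+1) coefz f i * coefz g (n - i)).

Fact fps_addA : associative fps_add.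
Proof. by move=> f g h; apply: fps_eq => n /=; rewrite addrA. Qed.
Fact fps_addC : commutative fps_add.
Proof. by move=> f g; apply: fps_eq => n /=; rewrite addrC. Qed.
Fact fps_add0 : left_id fps0 fps_add.
Proof. by move=> f; apply: fps_eq => n /=; rewrite add0r. Qed.
Fact fps_addN : left_inverse fps0 fps_opp fps_add.
Proof. by move=> f; apply: fps_eq => n /=; rewrite addNr. Qed.

HB.instance Definition _ :=
  GRing.isZmodule.Build (fps A) fps_addA fps_addC fps_add0 fps_addN.

Let trunc n f : {poly A} := \poly_(i < n.+1) coefz f i.

Let coef_trunc n f i : (i <= n)%N -> (trunc n f)`_i = coefz f i.
Proof. by move=> le_in; rewrite coef_poly ltnS le_in. Qed.

Let coef_mul n f g i : (i <= n)%N ->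
  coefz (fps_mul f g) i = (trunc n f * trunc n g)`_i.
Proof.
move=> le_in; rewrite coefM /=; apply: eq_bigr => j _.
by rewrite !coef_trunc // ?(leq_trans (leq_subr _ _)) // (leq_trans (leq_ord j)).
Qed.

Fact fps_mulA : associative fps_mul.
Proof.
move=> f g h; apply: fps_eq => n.
transitivity (trunc n f * trunc n g * trunc n h)`_n; last first.
  rewrite coefM; apply: eq_bigr => j _.
  by rewrite (coef_mul (n := n)) ?coef_trunc ?leq_subr ?leq_ord.
rewrite -mulrA coefM; apply: eq_bigr => j _.
by rewrite (coef_mul (n := n)) ?coef_trunc ?leq_subr ?leq_ord.
Qed.
Fact fps_mulC : commutative fps_mul.
Proof. by move=> f g; apply: fps_eq => n; rewrite !(coef_mul (n := n)) // mulrC. Qed.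
Fact fps_mul1 : left_id fps1 fps_mul.
Proof.
move=> f; apply: fps_eq => n /=; rewrite big_ord_recl /= mul1r subn0.
by rewrite big1 ?addr0 // => i _; rewrite mul0r.
Qed.
Fact fps_mulDl : left_distributive fps_mul +%R.
Proof.
move=> f g h; apply: fps_eq => n /=; rewrite -big_split /=.
by apply: eq_bigr => i _; rewrite mulrDl.
Qed.
Fact fps1_neq0 : fps1 != 0.
Proof.
apply/eqP => /(congr1 (fun f => coefz f 0%N)) /= /eqP.
by rewrite oner_eq0.
Qed.

HB.instance Definition _ :=
  GRing.Zmodule_isComNzRing.Build (fps A)
    fps_mulA fps_mulC fps_mul1 fps_mulDl fps1_neq0.

Definition fps_unit : pred (fps A) := fun f => `[< exists g, g * f = 1 >].
Definition fps_inv f : fps A :=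
  if pselect (exists g, g * f = 1) is left ex then projT1 (cid ex) else f.

Fact fps_mulVr : {in fps_unit, left_inverse 1 fps_inv *%R}.
Proof.
move=> f /asboolP uf; rewrite /fps_inv; case: pselect => // ex.
exact: projT2 (cid ex).
Qed.
Fact fps_unitP f g : g * f = 1 -> fps_unit f.
Proof. by move=> gf; apply/asboolP; exists g. Qed.
Fact fps_inv_out : {in [predC fps_unit], fps_inv =1 id}.
Proof. by move=> f /asboolPn uf; rewrite /fps_inv; case: pselect. Qed.

HB.instance Definition _ :=
  GRing.ComNzRing_hasMulInverse.Build (fps A) fps_mulVr fps_unitP fps_inv_out.

Definition constz (a : A) : fps A := FPS (fun n => if n == 0%N then a else 0).
Definition zvar : fps A := FPS (fun n => (n == 1%N)%:R).
Definition dz f : fps A := FPS (fun n => coefz f n.+1 *+ n.+1).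

End FPSRing.

Arguments zvar {A}.

Definition e_positive_series (f : fps symfun) : Prop :=
  forall n, e_positive (coefz f n).

Definition Eser : fps symfun := FPS esf.
Definition Dser : fps symfun := Eser - zvar * dz Eser.
Definition XPser : fps symfun := FPS (fun n => chromatic (path_graph n)).
Definition XCser : fps symfun :=
  FPS (fun n => if (2 <= n)%N then chromatic (cycle_graph n) else 0).

(* The rational functions at hand are those with the common denominator D(z)
   of the generating functions of paths and cycles. *)
Definition e_positive_numerator (f : fps symfun) : Prop :=
  Dser \is a GRing.unit /\
  exists2 num : fps symfun, e_positive_series num & f = num / Dser.

(* Main.v *)
Require Import Defs.
From HB Require Import structures.
From mathcomp Require Import all_boot all_order all_algebra.
From mathcomp Require Import boolp mpoly.
From mathcomp Require Import ring zify.
Import GRing.Theory Num.Theory.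
Local Open Scope ring_scope.

Set Implicit Arguments.
Unset Strict Implicit.
Unset Printing Implicit Defensive.

(** In N variables put y_a = x_a z, E = prod_a (1 + y_a) and let W_ab be the
    generating function, by length, of the words from a to b without equal
    adjacent letters. Removing the first letter gives
    (1 + y_a) W_ab = [a = b] y_a + y_a sum_c W_cb, hence
    (sum_a W_ab) (E - zE') = y_b prod_(c != b) (1 + y_c). Summing over b yields
    the path identity X_P D = E. A proper coloring of a cycle is one of the path
    with distinct ends, so X_C = X_P - 1 - sum_a W_aa, and the recursion at a = b,
    together with E z^2E'' = (zE')^2 - sum_a (y_a prod_(c != a) (1 + y_c))^2,
    yields X_C D = z^2E''. All five claims are then read off coefficientwise: the
    coefficient of z^n is, for n large, n(n-2) e_n; n(2n-5) e_n; (n-1)(n-3) e_n;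
    n e_n + (n-2) e_1 e_(n-1); and n(n-2) e_n + (n-2)^2 e_1 e_(n-1). *)

(** * Coefficients, units and the Euler operator for formal power series *)

Section FormalPowerSeries.

Variable A : comNzRingType.
Implicit Types f g : fps A.

Lemma coefzD f g n : coefz (f + g) n = coefz f n + coefz g n.
Proof. by []. Qed.

Lemma coefzN f n : coefz (- f) n = - coefz f n.
Proof. by []. Qed.

Lemma coefzM f g n : coefz (f * g) n = \sum_(i < n.+1) coefz f i * coefz g (n - i).
Proof. by []. Qed.

Lemma coefz1 n : coefz (1 : fps A) n = (n == 0%N)%:R.
Proof. by []. Qed.

Lemma coefz_sum (I : Type) (r : seq I) (P : pred I) (F : I -> fps A) n :
  coefz (\sum_(i <- r | P i) F i) n = \sum_(i <- r | P i) coefz (F i) n.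
Proof. by apply: (big_morph (fun f => coefz f n)). Qed.

Lemma coefzMn f k n : coefz (f *+ k) n = coefz f n *+ k.
Proof. by elim: k => // k IH; rewrite !mulrS coefzD IH. Qed.

Lemma coefz_constM a f n : coefz (constz a * f) n = a * coefz f n.
Proof.
rewrite coefzM big_ord_recl subn0 big1 ?addr0 // => i _.
by rewrite /= mul0r.
Qed.

Lemma coefz_zvarM f n : coefz (zvar * f) n = if n is m.+1 then coefz f m else 0.
Proof.
case: n => [|n]; rewrite coefzM big_ord_recl /= mul0r add0r ?big_ord0 //.
rewrite big_ord_recl /= mul1r subn1 big1 ?addr0 // => i _.
by rewrite /= mul0r.
Qed.

Lemma constzM a b : constz (a * b) = constz a * constz b :> fps A.
Proof. by apply: fps_eq => n; rewrite coefz_constM /=; case: eqP; rewrite ?mulr0. Qed.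

Lemma constz1 : constz 1 = 1 :> fps A.
Proof. by apply: fps_eq => -[|n]. Qed.

Lemma coefz_zvarX k n : coefz (zvar ^+ k : fps A) n = (n == k)%:R.
Proof. by elim: k n => [|k IH] [|n] //; rewrite exprS coefz_zvarM ?IH. Qed.

Lemma coefz_exp_small f k n :
  coefz f 0 = 0 -> (n < k)%N -> coefz (f ^+ k) n = 0.
Proof.
move=> f0; elim: k n => // k IH n lt_nk; rewrite exprS coefzM big_ord_recl f0 mul0r add0r.
by rewrite big1 // => i _; rewrite IH ?mulr0 // lift0; have := ltn_ord i; lia.
Qed.

(* The inverse of f is the geometric series in 1 - f. *)
Lemma fps_unit_coef0 f : coefz f 0 = 1 -> f \is a GRing.unit.
Proof.
move=> f0; pose h := 1 - f; have h0 : coefz h 0 = 0.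
  by rewrite coefzD coefzN f0 coefz1 subrr.
pose S m := \sum_(i < m) h ^+ i.
(* As [h] has no constant term, [h ^+ i] with i > n does not reach coefficient n. The partial sums
   thus stabilize, and the inverse can take its n-th coefficient from [S n.+1]. *)
have SE m n : (n < m)%N -> coefz (S m) n = coefz (S n.+1) n.
  elim: m => // m IH; rewrite ltnS leq_eqVlt => /orP[/eqP->//|lt_nm].
  rewrite -IH // /S big_ord_recr coefzD /= coefz_exp_small ?addr0 //.
apply/unitrP; exists (FPS (fun n => coefz (S n.+1) n)).
suff gf : FPS (fun n => coefz (S n.+1) n) * f = 1 by split; rewrite // mulrC.
apply: fps_eq => n.
have -> : coefz (FPS (fun n => coefz (S n.+1) n) * f) n = coefz (S n.+1 * f) n.
  by rewrite !coefzM; apply: eq_bigr => i _; rewrite [in RHS]SE.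
have -> : S n.+1 * f = 1 - h ^+ n.+1.
  rewrite -opprB subrX1 -mulNr opprB mulrC; congr (_ * _).
  by rewrite /h opprB addrCA subrr addr0.
by rewrite coefzD coefzN coefz_exp_small // subr0.
Qed.

(* The Euler operator [z d/dz]: it is a derivation acting diagonally on
   coefficients, so that z^2 f'' = theta (theta f) - theta f. *)
Definition theta f : fps A := FPS (fun n => coefz f n *+ n).

Lemma coefz_theta f n : coefz (theta f) n = coefz f n *+ n.
Proof. by []. Qed.

Lemma zvar_dz f : zvar * dz f = theta f.
Proof. by apply: fps_eq => -[|n]; rewrite coefz_zvarM. Qed.

Lemma zvar2_dz2 f : zvar ^+ 2 * dz (dz f) = theta (theta f) - theta f.
Proof.
apply: fps_eq => -[|[|n]]; rewrite expr2 -mulrA !coefz_zvarM coefzD coefzN /=.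
- by rewrite !mulr0n subr0.
- by rewrite !mulr1n subrr.
- by rewrite [in RHS]mulrSr addrK -!mulrnA mulnC.
Qed.

Lemma thetaD f g : theta (f + g) = theta f + theta g.
Proof. by apply: fps_eq => n; rewrite /= mulrnDl. Qed.

Lemma theta_sum (I : Type) (r : seq I) (P : pred I) (F : I -> fps A) :
  theta (\sum_(i <- r | P i) F i) = \sum_(i <- r | P i) theta (F i).
Proof.
apply: (big_morph theta thetaD).
by apply: fps_eq => n; rewrite /= mul0rn.
Qed.

Lemma thetaM f g : theta (f * g) = theta f * g + f * theta g.
Proof.
apply: fps_eq => n; rewrite coefzD !coefzM coefz_theta coefzM -sumrMnl -big_split.
apply: eq_bigr => i _ /=; rewrite mulrnAl mulrnAr -mulrnDr subnKC //.
by rewrite -ltnS.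
Qed.

Lemma theta1 : theta 1 = 0.
Proof. by apply: fps_eq => -[|n] /=; rewrite ?mul0rn. Qed.

Lemma theta_constz_zvar a : theta (constz a * zvar) = constz a * zvar.
Proof. by apply: fps_eq => -[|[|n]]; rewrite coefz_theta coefz_constM /= ?mulr0 ?mul0rn. Qed.

Lemma theta_prod (I : finType) (P : pred I) (F : I -> fps A) :
  theta (\prod_(i | P i) F i)
  = \sum_(i | P i) theta (F i) * \prod_(j | P j && (j != i)) F j.
Proof.
(* The induction needs duplicate-free lists: only there does the condition j != i remove exactly one
   factor. *)
have thetaX r : uniq r -> theta (\prod_(i <- r) F i)
    = \sum_(i <- r) theta (F i) * \prod_(j <- r | j != i) F j.
  elim: r => [|i r IH] /=; first by rewrite !big_nil theta1.
  case/andP=> ir ur; rewrite !big_cons thetaM IH // eqxx /=; congr (_ * _ + _).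
    rewrite [RHS]big_seq_cond [LHS]big_seq; apply: eq_bigl => j.
    by case: (boolP (j \in r)) => //= jr; apply/esym; apply: contraNneq ir => <-.
  rewrite mulr_sumr !big_seq; apply: eq_bigr => j jr.
  have ij : i != j by apply: contraNneq ir => ->.
  by rewrite big_cons ij; apply: mulrCA.
rewrite -big_filter thetaX ?filter_uniq ?index_enum_uniq // big_filter.
apply: eq_bigr => i _; congr (_ * _).
by rewrite -big_filter -filter_predI big_filter; apply: eq_bigl => j /=; rewrite andbC.
Qed.

End FormalPowerSeries.

(** * Words without equal adjacent letters, by first and last letter *)

Section Words.

Variables (A : comNzRingType) (N : nat) (x : 'I_N -> A).
Implicit Types a b c : 'I_N.

(** The index counts steps: the words have n+1 letters, so both end positions exist. *)
Definition walk_sum n a b : A :=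
  \sum_(k : {ffun 'I_n.+1 -> 'I_N} |
      [&& proper_coloring (G := path_graph n.+1) k, k ord0 == a & k ord_max == b])
    \prod_u x (k u).

Lemma proper_pathP n (k : {ffun 'I_n -> 'I_N}) :
  reflect (forall i j : 'I_n, i.+1 = j :> nat -> k i != k j)
          (proper_coloring (G := path_graph n) k).
Proof.
apply: (iffP forallP) => [kP i j ij | kP i].
  by have /forallP/(_ j) := kP i; rewrite /= /path_edge ij eqxx.
apply/forallP => j; apply/implyP => /orP[/eqP/kP //|/eqP/kP].
by rewrite eq_sym.
Qed.

(** The only edge a path may lack is the one joining its ends. On a single vertex that edge would be
    a loop, which [cycle_edge] discards, hence the size n+2. *)
Lemma proper_cycleP n (k : {ffun 'I_n.+2 -> 'I_N}) :
  proper_coloring (G := cycle_graph n.+2) k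
  = proper_coloring (G := path_graph n.+2) k && (k ord0 != k ord_max).
Proof.
have edgeP (i j : 'I_n.+2) : (ordS i == j) =
    (i.+1 == j :> nat) || ((i == ord_max) && (j == ord0)).
  rewrite -!val_eqE /=; have := ltn_ord i; have := ltn_ord j => hj hi.
  have [->|ni] := eqVneq (i : nat) n.+1; first by rewrite modnn; lia.
  by rewrite modn_small; lia.
apply/forallP/andP => [kP | [/proper_pathP kP k0] i].
  have kE i j : i != j -> ordS i == j -> k i != k j.
    by move=> ij Sij; have /forallP/(_ j) := kP i; rewrite /= /cycle_edge ij Sij.
  split; last by rewrite eq_sym; apply: kE; rewrite ?edgeP ?eqxx ?orbT.
  apply/proper_pathP => i j ij; apply: kE; rewrite ?edgeP ?ij ?eqxx //.
  by rewrite -val_eqE /= -ij; lia.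
apply/forallP => j; apply/implyP => /= /andP[_]; rewrite !edgeP.
case/orP=> /orP[/eqP|/andP[/eqP-> /eqP->]] //; try by rewrite eq_sym.
- exact: kP.
- by move/kP; rewrite eq_sym.
Qed.

Definition ffcons n a (k : {ffun 'I_n -> 'I_N}) : {ffun 'I_n.+1 -> 'I_N} :=
  [ffun i => if unlift ord0 i is Some j then k j else a].

Definition fftail n (k : {ffun 'I_n.+1 -> 'I_N}) : {ffun 'I_n -> 'I_N} :=
  [ffun i => k (lift ord0 i)].

Lemma ffcons0 n a (k : {ffun 'I_n -> 'I_N}) : ffcons a k ord0 = a.
Proof. by rewrite ffunE unlift_none. Qed.

Lemma ffconsS n a (k : {ffun 'I_n -> 'I_N}) i : ffcons a k (lift ord0 i) = k i.
Proof. by rewrite ffunE liftK. Qed.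

Lemma ffconsK n a : cancel (@ffcons n a) (@fftail n).
Proof. by move=> k; apply/ffunP => i; rewrite ffunE ffconsS. Qed.

Lemma fftailK n (k : {ffun 'I_n.+1 -> 'I_N}) : ffcons (k ord0) (fftail k) = k.
Proof.
by apply/ffunP => i; rewrite ffunE; case: unliftP => [j|] ->; rewrite ?ffunE.
Qed.

Lemma proper_ffcons n a (k : {ffun 'I_n.+1 -> 'I_N}) :
  proper_coloring (G := path_graph n.+2) (ffcons a k)
  = (k ord0 != a) && proper_coloring (G := path_graph n.+1) k.
Proof.
apply/proper_pathP/andP => [kP | [k0 /proper_pathP kP] i j].
  split; first by rewrite eq_sym -[X in X != _](ffcons0 a k) -(ffconsS a k) kP.
  by apply/proper_pathP => i j ij; rewrite -(ffconsS a k i) -(ffconsS a k j) kP //= /bump /= !add1n ij.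
have [i'|] := unliftP ord0 i => ->; have [j'|] := unliftP ord0 j => -> //;
  rewrite ?ffconsS ?ffcons0 /= /bump /= ?add1n.
- by case; apply: kP.
- case=> /esym j0; rewrite eq_sym (_ : j' = ord0) //; exact: val_inj.
Qed.

Lemma walk_sum0 a b : walk_sum 0 a b = (a == b)%:R * x a.
Proof.
rewrite /walk_sum; have [<-|ab] := eqVneq a b; last first.
  rewrite big_pred0 ?mul0r // => k; rewrite (_ : ord_max = ord0); last exact: val_inj.
  by apply/negP => /and3P[_ /eqP-> /eqP ab']; rewrite ab' eqxx in ab.
rewrite (big_pred1 [ffun=> a]) ?mul1r; first by rewrite big_ord1 ffunE.
move=> k; apply/and3P/eqP => [[_ /eqP ka _]|->].
  by apply/ffunP => i; rewrite ord1 ffunE.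
by rewrite !ffunE; split=> //; apply/proper_pathP => i j; rewrite !ord1.
Qed.

(** Deleting the first letter leaves a shorter word whose first letter c differs from a; the sum is
    then grouped by c. *)
Lemma walk_sumS n a b : walk_sum n.+1 a b = x a * \sum_(c | c != a) walk_sum n c b.
Proof.
rewrite /walk_sum (reindex_onto (@ffcons n.+1 a) (@fftail n.+1)); last first.
  by move=> k /and3P[_ /eqP<- _]; rewrite fftailK.
transitivity (\sum_(k : {ffun 'I_n.+1 -> 'I_N} |
   [&& proper_coloring (G := path_graph n.+1) k, k ord0 != a & k ord_max == b])
   x a * \prod_u x (k u)).
  apply: eq_big => k.
    rewrite ffconsK eqxx andbT proper_ffcons ffcons0 eqxx /=.
    rewrite (_ : ord_max = lift ord0 ord_max) ?ffconsS; last exact: val_inj.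
    by case: (k ord0 != a); rewrite ?andbF.
  move=> _; rewrite big_ord_recl ffcons0; congr (_ * _).
  by apply: eq_bigr => i _; rewrite ffconsS.
rewrite -mulr_sumr; congr (_ * _).
rewrite (partition_big (fun k : {ffun 'I_n.+1 -> 'I_N} => k ord0) (fun c => c != a)) /=;
  last by move=> k /and3P[].
apply: eq_bigr => c ca; apply: eq_bigl => k.
by case: (k ord0 =P c) => [->|_]; rewrite ?ca ?andbT ?andbF.
Qed.

(** The shift makes the exponent of z the number of letters. The empty word has no ends; it is the
    summand 1 in [walk_series_total]. *)
Definition walk_series a b : fps A :=
  FPS (fun n => if n is m.+1 then walk_sum m a b else 0).

Definition letter a : fps A := constz (x a) * zvar.

Lemma coefz_letterM a f n :
  coefz (letter a * f) n = if n is m.+1 then x a * coefz f m else 0.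
Proof.
rewrite /letter -mulrA coefz_constM coefz_zvarM.
by case: n => //; rewrite mulr0.
Qed.

Lemma walk_series_rec a b :
  walk_series a b = (a == b)%:R * letter a
    + letter a * (\sum_c walk_series c b - walk_series a b).
Proof.
rewrite [_%:R * _]mulrC -mulrDr; apply: fps_eq => -[|[|n]]; rewrite coefz_letterM //=.
  rewrite coefz_sum big1 // subr0 addr0 walk_sum0 mulrC.
  by case: (a == b).
rewrite walk_sumS coefz_sum /= [in RHS](bigD1 a) //= [_ + _ - _]addrAC subrr add0r.
by case: (a == b); rewrite add0r.
Qed.

(** * The product E of the 1 + x_a z and closed forms for the word series *)

Definition eseries : fps A := \prod_a (1 + letter a).
(** This is E / (1 + [letter a]), written without division. *)
Definition eseries_but a : fps A := \prod_(b | b != a) (1 + letter b).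

Lemma eseriesE a : eseries = (1 + letter a) * eseries_but a.
Proof. by rewrite /eseries (bigD1 a). Qed.

Lemma theta_letter a : theta (letter a) = letter a.
Proof. exact: theta_constz_zvar. Qed.

Lemma theta_letter1 a : theta (1 + letter a) = letter a.
Proof. by rewrite thetaD theta1 add0r theta_letter. Qed.

Lemma theta_eseries : theta eseries = \sum_a letter a * eseries_but a.
Proof. by rewrite theta_prod; apply: eq_bigr => a _; rewrite theta_letter1. Qed.

(** The identity holds letter by letter. With y = [letter a], F = [eseries_but a] and p = y F, both
    E (theta p - p) and p (theta E - p) equal p (1 + y) theta F. *)
Lemma theta2_eseries :
  eseries * (theta (theta eseries) - theta eseries)
  = theta eseries ^+ 2 - \sum_a (letter a * eseries_but a) ^+ 2.
Proof.
have -> : theta (theta eseries) - theta eseries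
    = \sum_a (theta (letter a * eseries_but a) - letter a * eseries_but a).
  by rewrite theta_eseries theta_sum sumrB.
have -> : theta eseries ^+ 2 = \sum_a letter a * eseries_but a * theta eseries.
  by rewrite -mulr_suml -theta_eseries.
rewrite mulr_sumr -sumrB; apply: eq_bigr => a _.
rewrite thetaM theta_letter.
have -> : theta eseries
    = letter a * eseries_but a + (1 + letter a) * theta (eseries_but a).
  by rewrite (eseriesE a) thetaM theta_letter1.
by rewrite (eseriesE a); ring.
Qed.

(* Multiplying the walk recursion by the product of the [1 + x_b z], b <> a,
   clears the denominator 1 + x_a z of its solution. *)
Lemma walk_series_from b :
  (\sum_a walk_series a b) * (eseries - theta eseries) = letter b * eseries_but b.
Proof.
set H := \sum_a walk_series a b.
have : H * eseries = \sum_a ((a == b)%:R * (letter a * eseries_but a)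
                             + H * (letter a * eseries_but a)).
  rewrite mulr_suml; apply: eq_bigr => a _; rewrite (eseriesE a).
  have -> : walk_series a b * ((1 + letter a) * eseries_but a) =
      (walk_series a b + letter a * walk_series a b) * eseries_but a by ring.
  by rewrite {1}walk_series_rec -/H; ring.
rewrite big_split -mulr_sumr -theta_eseries /= => HE.
rewrite mulrBr HE addrK (bigD1 b) //= eqxx mul1r big1 ?addr0 // => a /negPf->.
by rewrite mul0r.
Qed.

Lemma walk_series_total :
  (1 + \sum_a \sum_b walk_series a b) * (eseries - theta eseries) = eseries.
Proof.
rewrite exchange_big mulrDl mul1r mulr_suml.
under eq_bigr do rewrite walk_series_from.
by rewrite -theta_eseries subrK.
Qed.

Lemma eseries_unit : eseries \is a GRing.unit.
Proof.
apply/fps_unit_coef0; rewrite /eseries.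
elim/big_rec: _ => // a f _ f0.
by rewrite mulrDl mul1r coefzD coefz_letterM addr0.
Qed.

(** The right-hand side is theta E - z^2 E''. Since (X_P - 1) D = E - D = theta E, removing the
    closed words from X_P - 1 leaves z^2 E'' for the cycles. *)
Lemma walk_series_closed :
  (\sum_a walk_series a a) * (eseries - theta eseries)
  = theta eseries *+ 2 - theta (theta eseries).
Proof.
(* The extra factor E makes [theta2_eseries] applicable and supplies the 1 + y_a that each recursion
   needs. *)
apply: (mulrI eseries_unit).
have -> : theta eseries *+ 2 - theta (theta eseries)
  = theta eseries - (theta (theta eseries) - theta eseries) by ring.
rewrite [in RHS]mulrBr theta2_eseries opprB addrCA.
set D := eseries - theta eseries.
have -> : eseries * theta eseries - theta eseries ^+ 2 = theta eseries * D by rewrite /D; ring.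
rewrite {1}theta_eseries addrC !mulr_suml mulr_sumr -big_split /=.
(* With p = [letter a * eseries_but a], what remains is E W_aa D = p D + p^2: the recursion at a = b
   turns the left side into p D + p (sum_b W_ba) D, and [walk_series_from] evaluates the last
   product. *)
apply: eq_bigr => a _.
have Wa := walk_series_rec a a; rewrite eqxx mul1r in Wa.
have Ha := walk_series_from a; rewrite -/D in Ha.
transitivity ((walk_series a a + letter a * walk_series a a) * eseries_but a * D).
  by rewrite (eseriesE a); ring.
rewrite {1}Wa; transitivity (letter a * eseries_but a * D
   + letter a * eseries_but a * ((\sum_b walk_series b a) * D)); first by ring.
by rewrite Ha; ring.
Qed.

(** Expanding the product chooses y_a or 1 for each letter. The sum over sets has the shape in which
    [mesym] is defined, so it matches [esf] directly. *)
Lemma coefz_eseries n :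
  coefz eseries n = \sum_(h : {set 'I_N} | #|h| == n) \prod_(a in h) x a.
Proof.
rewrite /eseries; under eq_bigr do rewrite addrC.
rewrite bigA_distr coefz_sum (bigID (fun h : {set 'I_N} => #|h| == n)) /=.
have hE (h : {set 'I_N}) : \prod_a (if a \in h then letter a else 1)
    = constz (\prod_(a in h) x a) * zvar ^+ #|h|.
  rewrite -big_mkcond /= /letter big_split /= prodr_const; congr (_ * _).
  by rewrite (big_morph _ (@constzM A) (@constz1 A)).
rewrite [X in _ + X]big1 ?addr0 => [|h /negPf hn].
  apply: eq_bigr => h /eqP hn.
  by rewrite hE hn coefz_constM coefz_zvarX eqxx mulr1.
by rewrite hE coefz_constM coefz_zvarX eq_sym hn mulr0.
Qed.

Lemma walk_sum_total n :
  \sum_a \sum_b walk_sum n a b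
  = \sum_(k : {ffun 'I_n.+1 -> 'I_N} | proper_coloring (G := path_graph n.+1) k)
      \prod_u x (k u).
Proof.
rewrite [RHS](partition_big (fun k : {ffun 'I_n.+1 -> 'I_N} => k ord0) xpredT) //.
apply: eq_bigr => a _.
rewrite [RHS](partition_big (fun k : {ffun 'I_n.+1 -> 'I_N} => k ord_max) xpredT) //.
by apply: eq_bigr => b _; apply: eq_bigl => k; rewrite andbA.
Qed.

Lemma walk_sum_closed n :
  \sum_a walk_sum n a a
  = \sum_(k : {ffun 'I_n.+1 -> 'I_N} |
        proper_coloring (G := path_graph n.+1) k && (k ord0 == k ord_max))
      \prod_u x (k u).
Proof.
rewrite [RHS](partition_big (fun k : {ffun 'I_n.+1 -> 'I_N} => k ord0) xpredT) //.
apply: eq_bigr => a _; apply: eq_bigl => k; rewrite -andbA; congr (_ && _).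
by rewrite [RHS]andbC; case: eqP => [->|//]; rewrite eq_sym.
Qed.

End Words.

(** * Transfer to N variables and the path and cycle identities *)

Definition specialize N (f : symfun) : {mpoly rat[N]} := f N.

Fact specialize_zmod N : zmod_morphism (@specialize N).
Proof. by []. Qed.

Fact specialize_monoid N : monoid_morphism (@specialize N).
Proof. by []. Qed.

HB.instance Definition _ N :=
  GRing.isZmodMorphism.Build symfun {mpoly rat[N]} (@specialize N) (@specialize_zmod N).
HB.instance Definition _ N :=
  GRing.isMonoidMorphism.Build symfun {mpoly rat[N]} (@specialize N) (@specialize_monoid N).

Definition specializez N (f : fps symfun) : fps {mpoly rat[N]} :=
  FPS (fun n => specialize N (coefz f n)).

Lemma specializez_inj (f g : fps symfun) :
  (forall N, specializez N f = specializez N g) -> f = g.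
Proof.
move=> fg; apply: fps_eq => n; apply: symfun_eq => N.
by have /(congr1 (fun h => coefz h n)) := fg N.
Qed.

Lemma specializezM N : {morph @specializez N : f g / f * g}.
Proof.
move=> f g; apply: fps_eq => n /=; rewrite rmorph_sum.
by apply: eq_bigr => i _; rewrite rmorphM.
Qed.

Lemma specializezB N : {morph @specializez N : f g / f - g}.
Proof. by []. Qed.

Lemma specializez_theta N f : specializez N (theta f) = theta (specializez N f).
Proof. by apply: fps_eq => n /=; rewrite rmorphMn. Qed.

Lemma specializez_Eser N : specializez N Eser = eseries (fun a => 'X_a).
Proof. by apply: fps_eq => n; rewrite coefz_eseries. Qed.

Lemma coefz_specializez_XPser0 N : coefz (specializez N XPser) 0 = 1.
Proof. exact: (congr1 (@specialize N) chromatic_path0). Qed.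

Lemma specializez_XPser N :
  specializez N XPser = 1 + \sum_a \sum_b walk_series (fun a => 'X_a) a b.
Proof.
apply: fps_eq => -[|n]; rewrite coefzD coefz1 coefz_sum.
  rewrite big1 => [|a _]; last by rewrite coefz_sum big1.
  by rewrite addr0 coefz_specializez_XPser0.
under eq_bigr do rewrite coefz_sum.
by rewrite /= walk_sum_total add0r.
Qed.

Lemma specializez_XCser N :
  specializez N XCser
  = specializez N XPser - 1 - \sum_a walk_series (fun a => 'X_a) a a.
Proof.
apply: fps_eq => -[|[|n]]; rewrite !coefzD !coefzN coefz1 coefz_sum.
- by rewrite big1 // subr0 coefz_specializez_XPser0 subrr.
(* A one-letter word starts and ends with the same letter, so in degree 1 the closed words cancel
   all of [XPser], in agreement with the value 0 set in [XCser]. *)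
- rewrite subr0 specializez_XPser coefzD coefz_sum coefz1 add0r.
  rewrite -sumrB big1 // => a _; rewrite coefz_sum /= (bigD1 a) //= addrC addrK.
  by rewrite big1 // => b /negPf; rewrite walk_sum0 eq_sym => ->; rewrite mul0r.
- rewrite subr0 /= walk_sum_closed; apply/esym/eqP; rewrite subr_eq; apply/eqP.
  rewrite /specialize /= /chromatic_poly.
  rewrite [LHS](bigID (fun k : {ffun 'I_n.+2 -> 'I_N} => k ord0 == k ord_max)) /= addrC.
  by congr (_ + _); apply: eq_bigl => k; rewrite proper_cycleP.
Qed.

Lemma DserE : Dser = Eser - theta Eser.
Proof. by rewrite /Dser zvar_dz. Qed.

Lemma esf0 : esf 0 = 1.
Proof. by apply: symfun_eq => N; rewrite /= mesym0E. Qed.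

Lemma Dser_unit : Dser \is a GRing.unit.
Proof.
apply: fps_unit_coef0; rewrite DserE coefzD coefzN coefz_theta mulr0n subr0.
exact: esf0.
Qed.

Lemma XPser_Dser : XPser * Dser = Eser.
Proof.
apply: specializez_inj => N; rewrite DserE specializezM specializezB.
by rewrite specializez_theta specializez_XPser specializez_Eser walk_series_total.
Qed.

Lemma XCser_Dser : XCser * Dser = theta (theta Eser) - theta Eser.
Proof.
apply: specializez_inj => N; rewrite specializezM specializez_XCser.
rewrite 2!mulrBl mul1r -specializezM XPser_Dser DserE !specializezB !specializez_theta.
by rewrite specializez_Eser walk_series_closed; ring.
Qed.

(** * Closure of e-positivity and the five coefficient computations *)

Lemma e_positive0 : e_positive 0.
Proof. by exists [::], (fun=> 0); split=> //; rewrite big_nil. Qed.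

Lemma e_positiveD f g : e_positive f -> e_positive g -> e_positive (f + g).
Proof.
move=> [s [c [us sP c0 ->]]] [t [d [ut tP d0 ->]]].
(* The two supports may overlap, while an expansion must list each partition once; both coefficient
   functions are therefore extended by zero to the merged support. *)
pose r := undup (s ++ t).
exists r, (fun la => (if la \in s then c la else 0) + (if la \in t then d la else 0)).
have extend (q : seq (seq nat)) (b : seq nat -> rat) : uniq q -> {subset q <= r} ->
    \sum_(la <- q) b la *: esf_part la
    = \sum_(la <- r) (if la \in q then b la else 0) *: esf_part la.
  move=> uq qr; rewrite [RHS](bigID (mem q)) /= [X in _ + X]big1 ?addr0; last first.
    by move=> la /negPf->; rewrite scale0r.
  rewrite -[RHS]big_filter.
  have -> : \sum_(la <- q) b la *: esf_part la
      = \sum_(la <- q) (if la \in q then b la else 0) *: esf_part la.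
    by apply: eq_big_seq => la ->.
  apply: perm_big; apply: uniq_perm; rewrite ?filter_uniq ?undup_uniq //.
  by move=> la; rewrite mem_filter andb_idr //; apply: qr.
split.
- exact: undup_uniq.
- by apply/allP => la; rewrite mem_undup mem_cat => /orP[/(allP sP)|/(allP tP)].
- move=> la _; apply: addr_ge0; case: ifP => //; [exact: c0 | exact: d0].
- have sr : {subset s <= r} by move=> la; rewrite mem_undup mem_cat => ->.
  have tr : {subset t <= r} by move=> la; rewrite mem_undup mem_cat orbC => ->.
  rewrite (extend _ _ us sr) (extend _ _ ut tr) -big_split /=.
  by apply: eq_bigr => la _; rewrite scalerDl.
Qed.

Lemma e_positive_esf_part la k : is_partition la -> e_positive (esf_part la *+ k).
Proof.
move=> laP; exists [:: la], (fun=> k%:R).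
split=> [//||? _|]; [by rewrite /= laP | exact: ler0n |].
by rewrite big_seq1 scaler_nat.
Qed.

Lemma e_positive_esf n k : e_positive (esf n *+ k).
Proof.
(* A partition has no part 0, so e_0 = 1 must come from the empty partition. *)
case: n => [|n].
  by have := @e_positive_esf_part [::] k isT; rewrite /esf_part big_nil esf0.
by have := @e_positive_esf_part [:: n.+1] k isT; rewrite /esf_part big_seq1.
Qed.

Lemma e_positive_esf1M n k : e_positive ((esf 1 * esf n.+1) *+ k).
Proof.
have := @e_positive_esf_part [:: n.+1; 1%N] k isT.
by rewrite /esf_part big_cons big_seq1 mulrC.
Qed.

Lemma e_positive_numeratorP (f num : fps symfun) :
  f * Dser = num -> e_positive_series num -> e_positive_numerator f.
Proof.
move=> <- pos; split; first exact: Dser_unit.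
by exists (f * Dser) => //; rewrite mulrK // Dser_unit.
Qed.

Theorem lemma3p3 :
  [/\ e_positive_series
        (zvar ^+ 2 * dz (dz Eser) - zvar * dz Eser + constz (esf 1) * zvar),
      e_positive_series
        (2%:R * zvar ^+ 2 * dz (dz Eser) - 3%:R * zvar * dz Eser
         + 3%:R * constz (esf 1) * zvar + 2%:R * constz (esf 2) * zvar ^+ 2)
    & e_positive_series
        (zvar ^+ 2 * dz (dz Eser) - 3%:R * zvar * dz Eser + 3%:R * Eser
         + constz (esf 2) * zvar ^+ 2)]
  /\
  (e_positive_numerator (XPser - (1 + constz (esf 1) * zvar))
   /\
   e_positive_numerator
     ((1 + constz (esf 1) * zvar) * XCser - XPser + 1 + constz (esf 1) * zvar)).
Proof.
have coefE := (coefzD, coefzN, coefzMn, coefz_constM, coefz_zvarX, coefz_theta).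
split; [split | split].
(* From N(N-1) - N = N(N-2), the only negative coefficient is -e_1 at N = 1, cancelled by e_1 z.
   Reading z as z^1 lets [coefz_zvarX] apply. *)
- rewrite zvar2_dz2 zvar_dz -[X in _ * X]expr1 => n; rewrite !coefE /=.
  case: n => [|[|n]] /=.
  + by rewrite [X in e_positive X](_ : _ = 0); [exact: e_positive0 | ring].
  + by rewrite [X in e_positive X](_ : _ = 0); [exact: e_positive0 | ring].
  + rewrite [X in e_positive X](_ : _ = esf n.+2 *+ (n.+2 * n)); last by ring.
    exact: e_positive_esf.
(* Here 2N(N-1) - 3N = N(2N-5) is -3 at N = 1 and -2 at N = 2, which the two correction terms
   cancel. *)
- rewrite -!(mulrA _%:R) zvar2_dz2 zvar_dz -[X in 3%:R * (_ * X)]expr1 !mulr_natl => n.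
  rewrite !coefE /=; case: n => [|[|[|n]]] /=.
  + by rewrite [X in e_positive X](_ : _ = 0); [exact: e_positive0 | ring].
  + by rewrite [X in e_positive X](_ : _ = 0); [exact: e_positive0 | ring].
  + by rewrite [X in e_positive X](_ : _ = 0); [exact: e_positive0 | ring].
  + rewrite [X in e_positive X](_ : _ = esf n.+3 *+ (n.+3 * (n * 2 + 1))); last by ring.
    exact: e_positive_esf.
(* Here N(N-1) - 3N + 3 = (N-1)(N-3) is negative only at N = 2, where e_2 z^2 cancels it; the
   constant term is 3. *)
- rewrite -!(mulrA _%:R) zvar2_dz2 zvar_dz !mulr_natl => n.
  rewrite !coefE /=; case: n => [|[|[|n]]] /=.
  + rewrite [X in e_positive X](_ : _ = esf 0 *+ 3); last by ring.
    exact: e_positive_esf.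
  + by rewrite [X in e_positive X](_ : _ = 0); [exact: e_positive0 | ring].
  + by rewrite [X in e_positive X](_ : _ = 0); [exact: e_positive0 | ring].
  + rewrite [X in e_positive X](_ : _ = esf n.+3 *+ (n.+2 * n)); last by ring.
    exact: e_positive_esf.
(* The numerator is E - (1 + e_1 z) D with E - D = theta E. In degree 1 it vanishes because e_0 =
   1. *)
- apply: (@e_positive_numeratorP _
      (theta Eser - constz (esf 1) * (zvar * (Eser - theta Eser)))).
    by rewrite mulrBl XPser_Dser DserE; ring.
  move=> n; rewrite !(coefE, coefz_zvarM) /=; case: n => [|[|n]] /=.
  + by rewrite [X in e_positive X](_ : _ = 0); [exact: e_positive0 | ring].
  + rewrite [X in e_positive X](_ : _ = 0); first exact: e_positive0.
    by rewrite esf0; ring.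
  + rewrite [X in e_positive X](_ : _ = esf n.+2 *+ n.+2 + (esf 1 * esf n.+1) *+ n).
      by apply: e_positiveD; [apply: e_positive_esf | apply: e_positive_esf1M].
    by ring.
(* The numerator is (1 + e_1 z)(z^2 E'' + D) - E, where z^2 E'' + D = theta (theta E) - 2 theta E +
   E has coefficients (N-1)^2 e_N; the product with e_1 z shifts this to (N-2)^2 e_1 e_(N-1). *)
- apply: (@e_positive_numeratorP _ (theta (theta Eser) - theta Eser *+ 2
      + constz (esf 1) * (zvar * (theta (theta Eser) - theta Eser *+ 2 + Eser)))).
    transitivity ((1 + constz (esf 1) * zvar) * (XCser * Dser) - XPser * Dser
      + (1 + constz (esf 1) * zvar) * Dser); first by ring.
    by rewrite XPser_Dser XCser_Dser DserE; ring.
  move=> n; rewrite !(coefE, coefz_zvarM) /=; case: n => [|[|n]] /=.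
  + by rewrite [X in e_positive X](_ : _ = 0); [exact: e_positive0 | ring].
  + rewrite [X in e_positive X](_ : _ = 0); first exact: e_positive0.
    by rewrite esf0; ring.
  + rewrite [X in e_positive X](_ : _ = esf n.+2 *+ (n.+2 * n)
        + (esf 1 * esf n.+1) *+ (n ^ 2)).
      by apply: e_positiveD; [apply: e_positive_esf | apply: e_positive_esf1M].
    by ring.
Qed.
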